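(* Let $c\in\mathbb{E}^3$, $r>0$, let $x:U\to\mathbb{E}^3\setminus\{c\}$ be a regular patch and let $y=\Phi\circ x$ be its inverse patch, where $\Phi$ is the inversion with center $c$ and radius $r$. Let $k$ and $\widetilde{k}$ be the normal curvatures of $x$ and $y$, respectively. Then $$\widetilde{k}\circ\Phi_*=-\frac{1}{\lambda}k-\frac{2}{r^2}\eta,$$ where $\lambda(u,v)=\frac{r^2}{\|x(u,v)-c\|^2}$ and $\eta(u,v)=\langle U_x(u,v),x(u,v)-c\rangle$; that is, for every $(u,v)\in U$, $p=x(u,v)$, and every nonzero $v_p\in T_p(x)$, $\widetilde{k}(\Phi_{*p}v_p)=-\frac{1}{\lambda(u,v)}k(v_p)-\frac{2}{r^2}\eta(u,v)$.
   Context: $\mathbb{E}^3$ is Euclidean 3-space. The inversion with center $c$ and radius $r$ is $\Phi:\mathbb{E}^3\setminus\{c\}\to\mathbb{E}^3\setminus\{c\}$, $\Phi(p)=c+\frac{r^2}{\|p-c\|^2}(p-c)$, with tangent map $\Phi_{*p}(v_p)=\frac{r^2 v_p}{\|p-c\|^2}-\frac{2r^2\langle p-c,v_p\rangle}{\|p-c\|^4}(p-c)$. A regular patch is a smooth map $x:U\to\mathbb{E}^3\setminus\{c\}$, $U\subset\mathbb{R}^2$ open, with $x_u\times x_v\neq0$ everywhere; $y=\Phi\circ x$ is then also regular. At a parameter $(u,v)$, $T_p(x)=\mathrm{span}(x_u,x_v)$ with $p=x(u,v)$ (similarly for $y$ at $\Phi(p)$). The unit normals are $U_x=\frac{x_u\times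 x_v}{\|x_u\times x_v\|}$ and $U_y=\frac{y_u\times y_v}{\|y_u\times y_v\|}$. The shape operator $S$ of $x$ is the linear map with $S(x_u)=-\partial_uU_x$, $S(x_v)=-\partial_vU_x$; $I(a,b)=\langle a,b\rangle$, $II(a,b)=\langle Sa,b\rangle$. The normal curvature of $x$ in the direction of a nonzero tangent vector $v_p$ is $k(v_p)=\frac{II(v_p,v_p)}{I(v_p,v_p)}$. The corresponding objects for $y$ (using $U_y$) are defined likewise and denoted by tildes. *)

(* Defs.v *)
From HB Require Import structures.
From mathcomp Require Import all_boot all_order all_algebra.
From mathcomp Require Import boolp classical_sets functions reals topology.
From mathcomp Require Import normedtype derive.
From mathcomp Require Import ring.

Set Implicit Arguments.
Unset Strict Implicit.
Unset Printing Implicit Defensive.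

Import Order.TTheory GRing.Theory Num.Theory.
Import numFieldNormedType.Exports.

Local Open Scope classical_set_scope.
Local Open Scope ring_scope.

(** The carrier is ['rV[R]_3].  The library norm [`|v|] on row vectors is the
  sup norm; it is used only through the topology (open sets, limits,
  derivatives), for which the choice of norm is irrelevant.  Lengths are
  measured with [enorm]. *)

Section Euclidean.
Context {R : realType}.
Implicit Types u v : 'rV[R]_3.

Definition dot u v : R := \sum_i u 0 i * v 0 i.

Definition enorm v : R := Num.sqrt (dot v v).

(* indices are added modulo 3 in ['I_3] *)
Definition cross u v : 'rV[R]_3 :=
  \row_i (u 0 (i + 1) * v 0 (i + 2) - u 0 (i + 2) * v 0 (i + 1)).

(* The value at the center (which is [c], since [0^-1 = 0]) is junk. *)
Definition inversion (c : 'rV[R]_3) (r : R) (p : 'rV[R]_3) : 'rV[R]_3 :=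
  c + (r ^+ 2 / enorm (p - c) ^+ 2) *: (p - c).

End Euclidean.

(** A map defined on an open set [U] of the parameter plane is represented by a
  total function, of which only the values on [U] matter. *)

Section Patches.
Context {R : realType}.

Definition partial (i : 'I_2) (f : 'rV[R]_2 -> 'rV[R]_3) (q : 'rV[R]_2) :
  'rV[R]_3 := 'D_(delta_mx 0 i) f q.

Fixpoint Ck_on (k : nat) (U : set 'rV[R]_2) (f : 'rV[R]_2 -> 'rV[R]_3) : Prop :=
  if k is k'.+1 then
    forall i : 'I_2, (forall q, U q -> derivable f q (delta_mx 0 i)) /\
                     Ck_on k' U (partial i f)
  else forall q, U q -> {for q, continuous f}.

Definition smooth_on (U : set 'rV[R]_2) (f : 'rV[R]_2 -> 'rV[R]_3) : Prop :=
  forall k, Ck_on k U f.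

Implicit Types (x : 'rV[R]_2 -> 'rV[R]_3) (q : 'rV[R]_2) (v w : 'rV[R]_3).

Definition du x := partial 0 x.
Definition dv x := partial 1 x.

Definition normal_vector x q : 'rV[R]_3 := cross (du x q) (dv x q).

Definition regular_patch (c : 'rV[R]_3) (U : set 'rV[R]_2) x : Prop :=
  [/\ open U, smooth_on U x, forall q, U q -> x q != c
    & forall q, U q -> normal_vector x q != 0].

Definition tangent_frame x q : 2.-tuple 'rV[R]_3 := [tuple du x q; dv x q].

Definition tangent_plane x q : {vspace 'rV[R]_3} := <<tangent_frame x q>>%VS.

Definition unit_normal x q : 'rV[R]_3 :=
  (enorm (normal_vector x q))^-1 *: normal_vector x q.

(* The linear map with [S x_u = - d_u U_x] and [S x_v = - d_v U_x], extended
   linearly through the coordinates in the frame [(x_u, x_v)]; its values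
   outside the tangent plane are junk. *)
Definition shape_operator x q v : 'rV[R]_3 :=
  coord (tangent_frame x q) 0 v *: (- du (unit_normal x) q) +
  coord (tangent_frame x q) 1 v *: (- dv (unit_normal x) q).

Definition first_form v w : R := dot v w.

Definition second_form x q v w : R := dot (shape_operator x q v) w.

Definition normal_curvature x q v : R :=
  second_form x q v v / first_form v v.

End Patches.

Section Checks.
Context {R : realType}.

Lemma dot_self_gt0 (v : 'rV[R]_3) : v != 0 -> 0 < dot v v.
Proof.
move=> v0; rewrite lt_neqAle sumr_ge0 ?andbT => [|i _]; last exact: sqr_ge0.
apply: contra v0 => /eqP/esym/eqP.
rewrite psumr_eq0 => [/allP z|i _]; last exact: sqr_ge0.
apply/eqP/rowP => i; rewrite mxE.
by have := z i (mem_index_enum _); rewrite /= mulf_eq0 orbb => /eqP.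
Qed.

Lemma sqr_enorm (v : 'rV[R]_3) : enorm v ^+ 2 = dot v v.
Proof. by rewrite sqr_sqrtr// sumr_ge0// => i _; exact: sqr_ge0. Qed.

Lemma tangent_frame_free (x : 'rV[R]_2 -> 'rV[R]_3) q :
  normal_vector x q != 0 -> free (tangent_frame x q).
Proof.
move=> n0; rewrite /tangent_frame /= free_cons span_seq1 seq1_free; apply/andP.
split; apply: contra n0.
  move=> /vlineP[a e]; apply/eqP/rowP => i.
  by rewrite /normal_vector e !mxE; ring.
by move=> /eqP e; apply/eqP/rowP => i; rewrite /normal_vector e !mxE; ring.
Qed.

Let lincomb2 (V : lmodType R) (a b b' d d' : R) (m n : V) :
  (a * b + b') *: m + (a * d + d') *: n =
  a *: (b *: m + d *: n) + (b' *: m + d' *: n).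
Proof. by rewrite !scalerDl scalerDr !scalerA addrACA. Qed.

Lemma shape_operator_linear (x : 'rV[R]_2 -> 'rV[R]_3) q :
  linear (shape_operator x q).
Proof.
move=> a v w; rewrite /shape_operator.
have cE i : coord (tangent_frame x q) i (a *: v + w) =
    a * coord (tangent_frame x q) i v + coord (tangent_frame x q) i w.
  by rewrite linearP.
rewrite (cE 0) (cE 1).
exact: lincomb2.
Qed.

Lemma shape_operator_du (x : 'rV[R]_2 -> 'rV[R]_3) q :
  normal_vector x q != 0 ->
  shape_operator x q (du x q) = - du (unit_normal x) q.
Proof.
move=> /tangent_frame_free f; rewrite /shape_operator.
have cE j : coord (tangent_frame x q) j (du x q) = (0 == j)%:R.
  exact: (@coord_free _ _ _ (tangent_frame x q) 0 j f).
by rewrite (cE 0) (cE 1) eqxx scale1r scale0r addr0.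
Qed.

Lemma shape_operator_dv (x : 'rV[R]_2 -> 'rV[R]_3) q :
  normal_vector x q != 0 ->
  shape_operator x q (dv x q) = - dv (unit_normal x) q.
Proof.
move=> /tangent_frame_free f; rewrite /shape_operator.
have cE j : coord (tangent_frame x q) j (dv x q) = (1 == j)%:R.
  exact: (@coord_free _ _ _ (tangent_frame x q) 1 j f).
by rewrite (cE 0) (cE 1) eqxx scale1r scale0r add0r.
Qed.

Lemma is_diff_dot_self (c p : 'rV[R]_3) :
  is_diff p (fun z => dot (z - c) (z - c)) (fun v => 2 * dot (p - c) v).
Proof.
have D i : is_diff p (fun z : 'rV[R]_3 => z 0 i - c 0 i) (fun v => v 0 i).
  have l : linear (fun z : 'rV[R]_3 => z 0 i) by move=> a v w; rewrite !mxE.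
  pose L := GRing.isLinear.Build _ _ _ _ _ l.
  pose f : {linear 'rV[R]_3 -> R} := HB.pack (fun z : 'rV[R]_3 => z 0 i) L.
  have cf : continuous f by move=> z; exact: coord_continuous.
  have df : is_diff p f f.
    by apply: DiffDef; [exact: linear_differentiable | rewrite diff_lin].
  have := is_diffB df (is_diff_cst (c 0 i) p).
  by rewrite subr0.
have DM i : is_diff p (fun z : 'rV[R]_3 => (z 0 i - c 0 i) * (z 0 i - c 0 i))
    (fun v => 2 * ((p 0 i - c 0 i) * v 0 i)).
  apply: (is_diff_eq (is_diffM (D i) (D i))).
  by apply/funext => v /=; rewrite mulr2n mulrDl mul1r.
have e3 (F : 'I_3 -> R) : \sum_i F i = F 0 + F 1 + F 2.
  by rewrite !big_ord_recr big_ord0 /= add0r; congr (F _ + F _ + F _);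
    apply/val_inj.
apply: (is_diff_eq (f := (fun z => dot (z - c) (z - c)))); last first.
  by apply/funext => v; rewrite /dot e3 !mulrDr !mxE; reflexivity.
have -> : (fun z => dot (z - c) (z - c)) = (fun z : 'rV[R]_3 =>
    (z 0 0 - c 0 0) * (z 0 0 - c 0 0) + (z 0 1 - c 0 1) * (z 0 1 - c 0 1) +
    (z 0 2 - c 0 2) * (z 0 2 - c 0 2)).
  by apply/funext => z; rewrite /dot e3 !mxE.
exact: (is_diffD (is_diffD (DM 0) (DM 1)) (DM 2)).
Qed.

Lemma is_diff_scalev (k dk : 'rV[R]_3 -> R) (f df : 'rV[R]_3 -> 'rV[R]_3) p :
  is_diff p k dk -> is_diff p f df ->
  is_diff p (fun z => k z *: f z) (fun v => k p *: df v + dk v *: f p).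
Proof.
move=> hk hf.
have bl : bilinear_for (GRing.Scale.Law.clone _ _ *:%R _)
    (GRing.Scale.Law.clone _ _ *:%R _)
    (@GRing.scale R 'rV[R]_3 : R -> 'rV[R]_3 -> 'rV[R]_3).
  split=> [u'|u] a y z /=; first by rewrite scalerDl scalerA.
  by rewrite scalerDr !scalerA mulrC.
pose B := bilinear_isBilinear.Build R R 'rV[R]_3 'rV[R]_3 _ _ _ bl.
pose s : {bilinear R -> 'rV[R]_3 -> 'rV[R]_3} := HB.pack (@GRing.scale R 'rV[R]_3) B.
have cs : continuous (fun q : R * 'rV[R]_3 => s q.1 q.2).
  by move=> q; exact: scale_continuous.
have ds : is_diff (k p, f p) (fun q : R * 'rV[R]_3 => s q.1 q.2)
    (fun q => s (k p) q.2 + s q.1 (f p)).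
  by apply: DiffDef; [exact: differentiable_bilin | rewrite diff_bilin].
exact: (is_diff_comp (is_diff_pair hk hf) ds).
Qed.

Lemma is_diff_inversion (c : 'rV[R]_3) (r : R) (p : 'rV[R]_3) : p != c ->
  is_diff p (inversion c r) (fun v =>
    (r ^+ 2 / enorm (p - c) ^+ 2) *: v -
    (2 * r ^+ 2 * dot (p - c) v / enorm (p - c) ^+ 4) *: (p - c)).
Proof.
move=> pc; have d0 : dot (p - c) (p - c) != 0.
  by rewrite gt_eqF// dot_self_gt0// subr_eq0.
have hV : is_diff (dot (p - c) (p - c)) (GRing.inv : R -> R)
    (fun h : R => - (dot (p - c) (p - c)) ^- 2 *: h).
  by apply: DiffDef; [exact: differentiable_Rinv | rewrite diff_Rinv].
have hk := is_diffM (is_diff_cst (r ^+ 2) p) (is_diff_comp (is_diff_dot_self c p) hV).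
have hf := is_diffB (is_diff_id p) (is_diff_cst c p).
have := is_diffD (is_diff_cst c p) (is_diff_scalev hk hf).
rewrite (_ : cst c + _ = inversion c r); last first.
  by apply/funext => z; rewrite /inversion sqr_enorm.
move=> h; apply: (is_diff_eq h); apply/funext => v /=.
have -> : enorm (p - c) ^+ 4 = dot (p - c) (p - c) ^+ 2.
  by rewrite -sqr_enorm -exprM.
rewrite sqr_enorm.
transitivity (0 + ((r ^+ 2 * (dot (p - c) (p - c))^-1) *: (v - 0) +
   (r ^+ 2 * (- (dot (p - c) (p - c)) ^- 2 * (2 * dot (p - c) v)) +
    (dot (p - c) (p - c))^-1 * 0) *: (p - c))); first by [].
rewrite add0r subr0 mulr0 addr0 -scaleNr; congr (_ + _ *: _).
by field.
Qed.

(* The classical formula for the tangent map of the inversion. *)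
Lemma diff_inversion (c : 'rV[R]_3) (r : R) (p v : 'rV[R]_3) : p != c ->
  'd (inversion c r) p v =
    (r ^+ 2 / enorm (p - c) ^+ 2) *: v -
    (2 * r ^+ 2 * dot (p - c) v / enorm (p - c) ^+ 4) *: (p - c).
Proof. by move=> /is_diff_inversion h; rewrite diff_val. Qed.

End Checks.

(* Main.v *)
Require Import Defs.
From mathcomp Require Import all_boot all_order all_algebra.
From mathcomp Require Import boolp classical_sets functions reals topology.
From mathcomp Require Import normedtype derive.
From mathcomp Require Import realfun ring.

Set Implicit Arguments.
Unset Strict Implicit.
Unset Printing Implicit Defensive.

Import Order.TTheory GRing.Theory Num.Theory.
Import numFieldNormedType.Exports.

Local Open Scope classical_set_scope.
Local Open Scope ring_scope.

(** The tangent map of the inversion at [p] is [lambda *: rho], where [rho] is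
  the reflection in the plane orthogonal to [w = p - c].  Since [rho] is
  orthogonal of determinant [-1], the normal vector of [y] is
  [- lambda ^+ 2 *: rho (cross x_u x_v)], so that
  [U_y = - rho U_x = - U_x + (2 * eta / |w|^2) *: w].  Differentiating along a
  parameter line and using [<U_x, x_i> = 0] gives
  [S_y (y_i) = - rho (S_x x_i) - (2 * eta / |w|^2) *: rho x_i], and pairing
  with [lambda *: rho v] yields the formula. *)

(** * Calculus of directional derivatives for vector-valued maps *)

Section DirectionalDerivative.
Context {R : realType} {V : normedModType R}.
Implicit Types (t e : V) (f g : V -> 'rV[R]_3).

(** Smoothness of a patch is given through partial derivatives, so [f] is only assumed derivable in
    the direction [e]. Restricted to the line [h *: e + t] it has one real variable, where derivable
    and differentiable coincide, and the chain rule for differentials applies. *)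
Lemma is_derive_comp_diff (W W' : normedModType R) (f : V -> W) (g : W -> W')
    t e df dg :
  is_derive t e f df -> is_diff (f t) g dg -> is_derive t e (g \o f) (dg df).
Proof.
move=> [f1 f2] [dg1 dg2].
have h1 := iffLR (derivable1P _ _ _) f1.
have h2 := iffLR (derivable1_diffP _ _) h1.
have ft : f (0 *: e + t) = f t by rewrite scale0r add0r.
have h3 : differentiable g (f (0 *: e + t)) by rewrite ft.
have h4 : differentiable (g \o (fun h : R => f (h *: e + t))) 0.
  exact: (differentiable_comp h2 h3).
have lineD (W0 : normedModType R) (k : V -> W0) :
    'D_e k t = 'D_1 (fun h : R => k (h *: e + t)) 0.
  rewrite /derive; set g1 := fun h => h^-1 *: _; set g2 := fun h => h^-1 *: _.
  suff -> : g1 = g2 by [].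
  by apply/funext => h; rewrite /g1 /g2 /= addr0 scale0r add0r [_%:A]mulr1.
apply: DeriveDef.
  apply: (iffRL (derivable1P _ _ _)); exact: (iffRL (derivable1_diffP _ _) h4).
rewrite lineD (deriveE (1 : R) h4) (diff_comp h2 h3) /=.
have <- := deriveE (1 : R) h2.
by rewrite -lineD f2 ft dg2.
Qed.

Lemma is_derive_rowP f t e df :
  is_derive t e f df <->
  forall i, is_derive t e (fun z => f z 0 i) (df 0 i).
Proof.
split=> [[f1 <-] i|fi].
  apply: DeriveDef; first by move/derivable_mxP : f1; exact.
  by rewrite derive_mx// mxE.
have f1 : derivable f t e.
  by apply/derivable_mxP => i j; rewrite ord1; have [] := fi j.
apply: DeriveDef => //; apply/rowP => i; rewrite derive_mx// mxE.
by have [] := fi i.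
Qed.

Lemma sum3E (F : 'I_3 -> R) : \sum_i F i = F 0 + F 1 + F 2.
Proof.
by rewrite !big_ord_recr big_ord0 /= add0r; congr (F _ + F _ + F _);
  apply/val_inj.
Qed.

Lemma is_derive_dot f g t e df dg :
  is_derive t e f df -> is_derive t e g dg ->
  is_derive t e (fun z => dot (f z) (g z)) (dot df (g t) + dot (f t) dg).
Proof.
move=> /is_derive_rowP hf /is_derive_rowP hg.
have h i := is_deriveM (hf i) (hg i).
have := is_deriveD (is_deriveD (h 0) (h 1)) (h 2).
rewrite (_ : _ + _ + _ = fun z => dot (f z) (g z)); last first.
  by apply/funext => z; rewrite /dot sum3E.
move=> H; apply: (is_derive_eq H).
rewrite /dot !sum3E /GRing.scale /=; ring.
Qed.

Lemma is_derive_scalev (k : V -> R) f t e dk df :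
  is_derive t e k dk -> is_derive t e f df ->
  is_derive t e (fun z => k z *: f z) (dk *: f t + k t *: df).
Proof.
move=> hk /is_derive_rowP hf; apply/is_derive_rowP => i.
rewrite (_ : (fun z => _) = k * (fun z => f z 0 i)); last first.
  by apply/funext => z; rewrite mxE.
apply: (is_derive_eq (is_deriveM hk (hf i))).
rewrite !mxE /GRing.scale /=; ring.
Qed.

Lemma is_derive_inv (k : V -> R) t e dk : k t != 0 ->
  is_derive t e k dk -> is_derive t e (fun z => (k z)^-1) (- k t ^- 2 * dk).
Proof.
move=> k0 [k1 <-]; apply: DeriveDef; first exact: derivableV.
by rewrite deriveV.
Qed.

Lemma derivable_cross f g t e :
  derivable f t e -> derivable g t e ->
  derivable (fun z => cross (f z) (g z)) t e.
Proof.
move=> /derivable_mxP hf /derivable_mxP hg; apply/derivable_mxP => i j.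
rewrite ord1 {i}.
rewrite (_ : (fun z => _) =
    (fun z => f z 0 (j + 1)) * (fun z => g z 0 (j + 2)) -
    (fun z => f z 0 (j + 2)) * (fun z => g z 0 (j + 1))); last first.
  by apply/funext => z; rewrite mxE.
by apply: derivableB; apply: derivableM.
Qed.

(** The square root is differentiable at positive arguments, and [dot (f t) (f t)] is positive
    because [f t] is nonzero. *)
Lemma derivable_enorm f t e : f t != 0 ->
  derivable f t e -> derivable (fun z => enorm (f z)) t e.
Proof.
move=> f0 /derivableP hf.
have hs := is_derive1_sqrt (dot_self_gt0 f0).
have ds : differentiable (Num.sqrt : R -> R) (dot (f t) (f t)).
  by apply/derivable1_diffP; have [] := hs.
by have [] := is_derive_comp_diff (is_derive_dot hf hf) (differentiableP ds).
Qed.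

End DirectionalDerivative.

(** * Algebra of the dot and cross products and of reflections *)

Section Reflection.
Context {R : realType}.
Implicit Types u v w : 'rV[R]_3.

Lemma row3P u v : u 0 0 = v 0 0 -> u 0 1 = v 0 1 -> u 0 2 = v 0 2 -> u = v.
Proof.
move=> e0 e1 e2; apply/rowP => -[[|[|[|//]]] i3].
- by rewrite (_ : Ordinal i3 = 0)//; apply/val_inj.
- by rewrite (_ : Ordinal i3 = 1)//; apply/val_inj.
- by rewrite (_ : Ordinal i3 = 2)//; apply/val_inj.
Qed.

(** Resolves the indices modulo 3, so that [ring] and [field] meet the same three coordinates
    everywhere. *)
Lemma crossE u v :
  (cross u v 0 0 = u 0 1 * v 0 2 - u 0 2 * v 0 1) *
  (cross u v 0 1 = u 0 2 * v 0 0 - u 0 0 * v 0 2) *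
  (cross u v 0 2 = u 0 0 * v 0 1 - u 0 1 * v 0 0).
Proof.
by do !split; rewrite mxE; congr (u _ _ * v _ _ - u _ _ * v _ _); apply/val_inj.
Qed.

Lemma dotDl u v w : dot (u + v) w = dot u w + dot v w.
Proof. by rewrite /dot !sum3E !mxE; ring. Qed.

Lemma dotZl a v w : dot (a *: v) w = a * dot v w.
Proof. by rewrite /dot !sum3E !mxE; ring. Qed.

Lemma dotC v w : dot v w = dot w v.
Proof. by rewrite /dot !sum3E; ring. Qed.

Lemma dot_crossl u v : dot (cross u v) u = 0.
Proof. by rewrite /dot !sum3E !crossE; ring. Qed.

Lemma dot_crossr u v : dot (cross u v) v = 0.
Proof. by rewrite /dot !sum3E !crossE; ring. Qed.

Lemma crossZZ a b u v : cross (a *: u) (b *: v) = (a * b) *: cross u v.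
Proof. by apply/rowP => i; rewrite !mxE; ring. Qed.

Definition reflection w v := v - (2 * dot w v / dot w w) *: w.

Lemma reflection_linear w : linear (reflection w).
Proof.
move=> a u v; rewrite /reflection dotC dotDl dotZl !(dotC _ w).
by apply/rowP => i; rewrite !mxE; ring.
Qed.

Lemma reflectionD w u v :
  reflection w (u + v) = reflection w u + reflection w v.
Proof. by have := reflection_linear w 1 u v; rewrite !scale1r. Qed.

Lemma reflectionZ w a v : reflection w (a *: v) = a *: reflection w v.
Proof.
rewrite /reflection dotC dotZl (dotC v) scalerBr scalerA.
by congr (_ - _ *: _); ring.
Qed.

Lemma reflectionN w v : reflection w (- v) = - reflection w v.
Proof. by rewrite -scaleN1r reflectionZ scaleN1r. Qed.

Lemma dot_reflection w u v : w != 0 ->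
  dot (reflection w u) (reflection w v) = dot u v.
Proof.
move=> /dot_self_gt0 /lt0r_neq0; rewrite /reflection /dot !sum3E !mxE => w0.
by field.
Qed.

(** An orthogonal map commutes with the cross product up to its determinant, which is -1 here. This
    is the source of the sign in front of [k] in the final formula. *)
Lemma cross_reflection w u v : w != 0 ->
  cross (reflection w u) (reflection w v) = - reflection w (cross u v).
Proof.
move=> /dot_self_gt0 /lt0r_neq0; rewrite /dot sum3E => w0.
by apply: row3P; rewrite !(crossE, mxE) /dot !sum3E !crossE; field.
Qed.

Lemma enormZ a v : 0 <= a -> enorm (a *: v) = a * enorm v.
Proof.
move=> a0; rewrite /enorm dotZl dotC dotZl mulrA -expr2 sqrtrM ?sqr_ge0//.
by rewrite sqrtr_sqr ger0_norm.
Qed.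

Lemma enormN v : enorm (- v) = enorm v.
Proof. by congr Num.sqrt; rewrite /dot !sum3E !mxE; ring. Qed.

Lemma enorm_reflection w v : w != 0 -> enorm (reflection w v) = enorm v.
Proof. by move=> w0; rewrite /enorm dot_reflection. Qed.

Lemma diff_inversion_reflection (c p v : 'rV[R]_3) (r : R) : p != c ->
  'd (inversion c r) p v =
  (r ^+ 2 / enorm (p - c) ^+ 2) *: reflection (p - c) v.
Proof.
move=> pc; rewrite diff_inversion// /reflection [RHS]scalerBr [in RHS]scalerA.
have : dot (p - c) (p - c) != 0 by rewrite gt_eqF// dot_self_gt0// subr_eq0.
have -> : enorm (p - c) ^+ 4 = (enorm (p - c) ^+ 2) ^+ 2 by rewrite -exprM.
by rewrite sqr_enorm => d0; congr (_ - _ *: _); field.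
Qed.

End Reflection.

(** Pointwise linear algebra, with [w], [l] and [k] constants: both sides are linear in [v], so it
    suffices to compare them on the frame, where the hypotheses on the partial derivatives give the
    values. *)
Lemma shape_operator_reflection {R : realType} (x y : 'rV[R]_2 -> 'rV[R]_3)
    (q : 'rV[R]_2) (w v : 'rV[R]_3) (l k : R) :
  normal_vector x q != 0 -> normal_vector y q != 0 ->
  (forall i, partial i y q = l *: reflection w (partial i x q)) ->
  (forall i, partial i (unit_normal y) q =
    - reflection w (partial i (unit_normal x) q) +
    k *: reflection w (partial i x q)) ->
  v \in tangent_plane x q ->
  shape_operator y q (l *: reflection w v) =
  - reflection w (shape_operator x q v) - k *: reflection w v.
Proof.
move=> nx ny dy dN /coord_span; rewrite big_ord_recl big_ord1 /=.
move: (coord _ _ _) (coord _ _ _) => b a ->.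
have SD z u u' : shape_operator z q (a *: u + b *: u') =
    a *: shape_operator z q u + b *: shape_operator z q u'.
  rewrite shape_operator_linear; congr (_ + _).
  have := shape_operator_linear z q b u' 0.
  (* This instance yields [shape_operator z q 0 = 0], which clears the additive term of the previous
     one. *)
  have := shape_operator_linear z q (-1) 0 0.
  rewrite scaler0 addr0 scaleN1r addNr => ->.
  by rewrite !addr0.
have RD u u' : reflection w (a *: u + b *: u') =
    a *: reflection w u + b *: reflection w u'.
  by rewrite reflectionD !reflectionZ.
have -> : l *: reflection w (a *: du x q + b *: dv x q) =
    a *: du y q + b *: dv y q.
  move: (dy 0) (dy 1); rewrite -!/(du _ q) -!/(dv _ q) => -> ->.
  move: (du x q) (dv x q) => A B.
  by rewrite RD scalerDr !scalerA !(mulrC l).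
rewrite (SD y) (SD x (du x q)).
rewrite (shape_operator_du nx) (shape_operator_dv nx).
rewrite (shape_operator_du ny) (shape_operator_dv ny).
move: (dN 0) (dN 1); rewrite -!/(du _ q) -!/(dv _ q) => -> ->.
move: (du x q) (dv x q) (du _ q) (dv _ q) => A B A' B'.
rewrite !RD !reflectionN.
move: (reflection _ _) (reflection _ _) (reflection _ _) (reflection _ _).
by move=> {A B A' B'} A B C D; apply/rowP => j; rewrite !mxE; ring.
Qed.

(** * Normal, shape operator and normal curvature of the inverse patch *)

Section InversePatch.
Context {R : realType} {c : 'rV[R]_3} {r : R} {U : set 'rV[R]_2}.
Context {x : 'rV[R]_2 -> 'rV[R]_3}.
Hypotheses (r0 : 0 < r) (px : regular_patch c U x).
Let y := inversion c r \o x.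
Let lambda q := r ^+ 2 / enorm (x q - c) ^+ 2.

Let opU : open U. Proof. by have [] := px. Qed.
Let xc q : U q -> x q != c. Proof. by have [_ _ + _] := px; exact. Qed.
Let nx q : U q -> normal_vector x q != 0.
Proof. by have [_ _ _] := px; exact. Qed.
Let w0 q : U q -> x q - c != 0. Proof. by rewrite subr_eq0; exact: xc. Qed.

Let lambda_gt0 q : U q -> 0 < lambda q.
Proof.
by move=> Uq; rewrite /lambda divr_gt0 ?sqr_enorm ?dot_self_gt0 ?w0 ?exprn_gt0.
Qed.

Lemma derivable_patch q i : U q -> derivable x q (delta_mx 0 i).
Proof. by move=> Uq; have [_ /(_ 1%N)/(_ i)[+ _] _ _] := px; exact. Qed.

Lemma derivable_partial q i j : U q ->
  derivable (partial i x) q (delta_mx 0 j).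
Proof.
by move=> Uq; have [_ /(_ 2%N)/(_ i)[_ /(_ j)[+ _]] _ _] := px; exact.
Qed.

Lemma partial_inverse_patch q i : U q ->
  partial i y q = lambda q *: reflection (x q - c) (partial i x q).
Proof.
move=> Uq; rewrite -diff_inversion_reflection ?xc//.
have hx := derivableP (derivable_patch (i := i) Uq).
have [dF _] := is_diff_inversion r (xc Uq).
by have [_] := is_derive_comp_diff hx (differentiableP dF).
Qed.

Lemma normal_vector_inverse_patch q : U q ->
  normal_vector y q =
  lambda q ^+ 2 *: (- reflection (x q - c) (normal_vector x q)).
Proof.
move=> Uq; rewrite /normal_vector /du /dv !partial_inverse_patch//.
by rewrite crossZZ cross_reflection ?w0.
Qed.

(** The factor [lambda q ^+ 2] is nonzero and the reflection preserves lengths, so a zero normal of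
    [y] would force a zero normal of [x]. *)
Lemma normal_vector_inverse_patch_neq0 q : U q -> normal_vector y q != 0.
Proof.
move=> Uq; apply: contra_neq (nx Uq) => n0.
apply/eqP/negPn/negP => /dot_self_gt0.
rewrite -(dot_reflection _ _ (w0 Uq)).
have : reflection (x q - c) (normal_vector x q) = 0.
  move/eqP: n0; rewrite normal_vector_inverse_patch// scaler_eq0 oppr_eq0.
  by rewrite sqrf_eq0 gt_eqF ?lambda_gt0//= => /eqP.
by move=> ->; rewrite /dot !sum3E !mxE !mul0r !addr0 ltxx.
Qed.

(** The positive factor [lambda q ^+ 2] cancels on normalizing; the sign survives. *)
Lemma unit_normal_inverse_patch q : U q ->
  unit_normal y q = - reflection (x q - c) (unit_normal x q).
Proof.
move=> Uq; rewrite /unit_normal normal_vector_inverse_patch//.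
rewrite enormZ ?sqr_ge0// enormN enorm_reflection ?w0// reflectionZ.
rewrite scalerA invfM mulrAC mulVf ?mul1r ?scalerN//.
by rewrite sqrf_eq0 gt_eqF// lambda_gt0.
Qed.

Lemma derivable_unit_normal q i : U q ->
  derivable (unit_normal x) q (delta_mx 0 i).
Proof.
move=> Uq; have hn : derivable (normal_vector x) q (delta_mx 0 i).
  by apply: derivable_cross; exact: derivable_partial.
have en0 : enorm (normal_vector x q) != 0.
  by rewrite -sqrf_eq0 sqr_enorm gt_eqF// dot_self_gt0// nx.
have hk := is_derive_inv (k := fun z => enorm (normal_vector x z)) en0
    (derivableP (derivable_enorm (nx Uq) hn)).
by have [] := is_derive_scalev hk (derivableP hn).
Qed.

Lemma dot_unit_normal_partial q i : dot (unit_normal x q) (partial i x q) = 0.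
Proof.
rewrite /unit_normal dotZl; case: i => -[|[|//]] i2.
- by rewrite (_ : Ordinal i2 = 0) ?dot_crossl ?mulr0//; apply/val_inj.
- by rewrite (_ : Ordinal i2 = 1) ?dot_crossr ?mulr0//; apply/val_inj.
Qed.

(** With [w = x - c], the map to differentiate is [- N + k *: w], where [k] is [2 <N, w> / |w|^2].
    The term of the derivative of [k] in [<N_i, w>] completes [- N_i] to minus its reflection; the
    term from [1 / |w|^2], in [<x_i, w>], completes [k *: x_i] to [k] times the reflection of
    [x_i]. *)
Lemma partial_unit_normal_inverse_patch q i : U q ->
  partial i (unit_normal y) q =
  - reflection (x q - c) (partial i (unit_normal x) q) +
  (2 * dot (unit_normal x q) (x q - c) / dot (x q - c) (x q - c)) *:
    reflection (x q - c) (partial i x q).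
Proof.
move=> Uq.
set N := unit_normal x.
have d0 : dot (x q - c) (x q - c) != 0 by rewrite gt_eqF// dot_self_gt0// w0.
have hN : is_derive q (delta_mx 0 i) N (partial i N q).
  exact/derivableP/derivable_unit_normal.
have hw : is_derive q (delta_mx 0 i) (fun z => x z - c) (partial i x q).
  have := is_deriveB (derivableP (derivable_patch (i := i) Uq))
    (is_derive_cst c q (delta_mx 0 i)).
  by rewrite subr0.
have hk := is_deriveM (is_derive_dot hw hN) (is_derive_inv
    (k := fun z => dot (x z - c) (x z - c)) d0 (is_derive_dot hw hw)).
pose k z := 2 * (dot (x z - c) (N z) / dot (x z - c) (x z - c)).
have /is_derive_scalev/(_ hw) hs := is_deriveZ 2 hk : is_derive q _ k _.
have H := is_deriveN (is_deriveB hN hs).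
(* The formula for the normal of [y] is available only on [U]; since [U] is open it holds near [q],
   which suffices for the derivative at [q]. *)
have E : \forall z \near q, (- (N - (fun z => k z *: (x z - c)))) z =
   unit_normal y z.
  near=> z.
  rewrite unit_normal_inverse_patch; last by near: z; exact: open_nbhs_nbhs.
  by rewrite /reflection -mulrA.
case: (near_eq_is_derive E H) => _ D1; apply: (etrans D1); move=> {D1 H E hs}.
(* Tangency of [x_i] removes the remaining term of the derivative of [<N, w>]. *)
have no : dot (partial i x q) (N q) = 0 by rewrite dotC dot_unit_normal_partial.
rewrite no add0r (dotC (partial i x q)) (dotC (N q)) /reflection.
move: d0; rewrite -/N.
rewrite /k; move: (dot _ _) (dot _ _) (dot _ _) (dot _ _) => A B C D D0.
apply/rowP => j; rewrite !mxE /GRing.scale /=.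
by field.
Unshelve. all: by end_near. Qed.

Lemma shape_operator_inverse_patch q v : U q -> v \in tangent_plane x q ->
  shape_operator y q (lambda q *: reflection (x q - c) v) =
  - reflection (x q - c) (shape_operator x q v) -
  (2 * dot (unit_normal x q) (x q - c) / dot (x q - c) (x q - c)) *:
    reflection (x q - c) v.
Proof.
move=> Uq; apply: shape_operator_reflection.
- exact: nx.
- exact: normal_vector_inverse_patch_neq0.
- by move=> i; exact: partial_inverse_patch.
- by move=> i; exact: partial_unit_normal_inverse_patch.
Qed.

(** As the reflection is an isometry, the numerator is [lambda] times
    [- <S v, v> - (2 eta / |w|^2) <v, v>] and the denominator is [lambda^2 <v, v>]. The constant
    [2 / r ^+ 2] comes from [lambda |w|^2 = r^2]. *)
Lemma normal_curvature_inverse_patch q v :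
  U q -> v \in tangent_plane x q -> v != 0 ->
  normal_curvature y q ('d (inversion c r) (x q) v) =
  - (1 / lambda q) * normal_curvature x q v -
  2 / r ^+ 2 * dot (unit_normal x q) (x q - c).
Proof.
move=> Uq vT v0; rewrite diff_inversion_reflection ?xc// -/(lambda q).
rewrite /normal_curvature /second_form /first_form.
rewrite shape_operator_inverse_patch// -reflectionN.
(* Applied with [u] the negative of the shape operator of [x] at [v], the sign having just been
   moved inside the reflection. *)
have D l k u : dot (reflection (x q - c) u - k *: reflection (x q - c) v)
    (l *: reflection (x q - c) v) = l * (dot u v - k * dot v v).
  by rewrite dotC dotZl dotC dotDl -scaleNr dotZl !dot_reflection ?w0// mulNr.
rewrite D dotZl (dotC _ (_ *: _)) dotZl dot_reflection ?w0//.
rewrite -(scaleN1r (shape_operator _ _ _)) dotZl.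
rewrite /lambda sqr_enorm.
have : dot (x q - c) (x q - c) != 0 by rewrite gt_eqF// dot_self_gt0// w0.
have : dot v v != 0 by rewrite gt_eqF// dot_self_gt0.
have : r != 0 by rewrite gt_eqF.
move: (dot _ _) (dot _ _) (dot _ _) (dot _ _) => A B e f r1 h1 h2.
by field; rewrite r1 h1 h2.
Qed.

End InversePatch.

Theorem lemma4p4 (R : realType) (c : 'rV[R]_3) (r : R) (U : set 'rV[R]_2)
    (x : 'rV[R]_2 -> 'rV[R]_3) :
  0 < r -> regular_patch c U x ->
  let y := inversion c r \o x in
  let lambda := fun q => r ^+ 2 / enorm (x q - c) ^+ 2 in
  let eta := fun q => dot (unit_normal x q) (x q - c) in
  forall (q : 'rV[R]_2) (v : 'rV[R]_3),
    U q -> v \in tangent_plane x q -> v != 0 ->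
    normal_curvature y q ('d (inversion c r) (x q) v) =
      - (1 / lambda q) * normal_curvature x q v - 2 / r ^+ 2 * eta q.
Proof.
by move=> r0 px y lambda eta q v; exact: (normal_curvature_inverse_patch r0 px).
Qed.
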